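(* There is an algorithm which, given an $m\times n$ interval matrix $\mathbf{M}$ all of whose entries are nontrivial intervals ($\underline m_{ij}<\overline m_{ij}$ for all $i,j$), outputs ''YES'' together with a row permutation $\sigma$ and column permutation $\rho$ such that $\mathbf{M}(\sigma,\rho)$ has the strong Monge property if $\mathbf{M}$ is Monge permutable, and outputs ''NO'' otherwise, and which runs in time $O(m^2+n^2+mn)$.
   Context: An interval matrix $\mathbf{M}=[\underline{M},\overline{M}]$ with real $m\times n$ matrices $\underline{M}\le\overline{M}$ is the set $\{A\in\mathbb{R}^{m\times n}:\underline{M}\le A\le\overline{M}\}$ (entrywise), with entries $\mathbf{m}_{ij}=[\underline{m}_{ij},\overline{m}_{ij}]$. A real matrix $A$ is Monge if $a_{ij}+a_{k\ell}\le a_{i\ell}+a_{kj}$ for all $i<k$, $j<\ell$; an interval matrix has the strong Monge property if every real matrix it contains is Monge. For permutations $\sigma$ of rows and $\pi$ of columns, $\mathbf{M}(\sigma,\pi)$ is the interval matrix with $(i,j)$ entry $\mathbf{m}_{\sigma(i),\pi(j)}$; $\mathbf{M}$ is Monge permutable if there exist $\sigma,\pi$ such that $\mathbf{M}(\sigma,\pi)$ has the strong Monge property. Running time counts arithmetic operations and comparisons on reals at unit cost. *)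

(* Defs.v *)
From HB Require Import structures.
From mathcomp Require Import all_boot all_order all_fingroup all_algebra.
From mathcomp Require Import reals.

Set Implicit Arguments.
Unset Strict Implicit.
Unset Printing Implicit Defensive.

Import Order.TTheory GRing.Theory Num.Theory.

Section IntervalMatrices.
Local Open Scope ring_scope.
Variables (R : realType) (m n : nat).

Record imatrix := IMatrix {
  imx_lo : 'M[R]_(m, n);
  imx_up : 'M[R]_(m, n);
  imx_le : forall i j, imx_lo i j <= imx_up i j }.

Definition in_imatrix (M : imatrix) (A : 'M[R]_(m, n)) : Prop :=
  forall i j, imx_lo M i j <= A i j <= imx_up M i j.

Definition nontrivial_entries (M : imatrix) : Prop :=
  forall i j, imx_lo M i j < imx_up M i j.

Definition monge (A : 'M[R]_(m, n)) : Prop :=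
  forall (i k : 'I_m) (j l : 'I_n), (i < k)%N -> (j < l)%N ->
    A i j + A k l <= A i l + A k j.

Definition strong_monge (M : imatrix) : Prop :=
  forall A, in_imatrix M A -> monge A.

Definition permute_mx (A : 'M[R]_(m, n)) (sigma : 'S_m) (rho : 'S_n) :
  'M[R]_(m, n) := \matrix_(i, j) A (sigma i) (rho j).

Fact permute_imx_le (M : imatrix) (sigma : 'S_m) (rho : 'S_n) i j :
  permute_mx (imx_lo M) sigma rho i j <= permute_mx (imx_up M) sigma rho i j.
Proof. by rewrite !mxE imx_le. Qed.

Definition permute_imx (M : imatrix) (sigma : 'S_m) (rho : 'S_n) : imatrix :=
  IMatrix (permute_imx_le M sigma rho).

Definition monge_permutable (M : imatrix) : Prop :=
  exists (sigma : 'S_m) (rho : 'S_n), strong_monge (permute_imx M sigma rho).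

End IntervalMatrices.

(* Algorithms are programs of a real RAM, written in a structured imperative
   language.  The memory consists of arrays of natural numbers and arrays of
   reals; arrays are named by fixed numbers occurring in the program text, and
   a scalar variable is cell 0 of an array.  Memory access is indirect: an
   index is the value of a natural-number expression.

   The model is uniform: programs mention neither the matrix dimensions nor
   real parameters; the only real constants are 0 and 1.  Reals can be combined
   arithmetically and compared, but not converted to natural numbers.  Natural
   numbers can only be added, subtracted (truncated at 0) and compared, so that
   unit-cost arithmetic on them cannot generate long integers quickly. *)

Inductive nexpr :=
  | NConst of nat
  | NLoad of nat & nexpr
  | NAdd of nexpr & nexpr
  | NSub of nexpr & nexpr.

Inductive rexpr :=
  | RZero
  | ROne
  | RLoad of nat & nexpr
  | RAdd of rexpr & rexpr
  | RSub of rexpr & rexpr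
  | RMul of rexpr & rexpr
  | RDiv of rexpr & rexpr.

Inductive bexpr :=
  | NEq of nexpr & nexpr
  | NLt of nexpr & nexpr
  | RLe of rexpr & rexpr
  | RLt of rexpr & rexpr
  | BNot of bexpr
  | BAnd of bexpr & bexpr.

Inductive program :=
  | Skip
  | NStore of nat & nexpr & nexpr
  | RStore of nat & nexpr & rexpr
  | Seq of program & program
  | If of bexpr & program & program
  | While of bexpr & program.

(* The cost of an expression is its number of nodes: every arithmetic
   operation, comparison, connective, constant and memory access costs 1. *)

Fixpoint ncost (e : nexpr) : nat :=
  match e with
  | NConst _ => 1
  | NLoad _ i => (ncost i).+1
  | NAdd e1 e2 | NSub e1 e2 => (ncost e1 + ncost e2).+1
  end.

Fixpoint rcost (e : rexpr) : nat :=
  match e with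
  | RZero | ROne => 1
  | RLoad _ i => (ncost i).+1
  | RAdd e1 e2 | RSub e1 e2 | RMul e1 e2 | RDiv e1 e2 =>
      (rcost e1 + rcost e2).+1
  end.

Fixpoint bcost (b : bexpr) : nat :=
  match b with
  | NEq e1 e2 | NLt e1 e2 => (ncost e1 + ncost e2).+1
  | RLe e1 e2 | RLt e1 e2 => (rcost e1 + rcost e2).+1
  | BNot b1 => (bcost b1).+1
  | BAnd b1 b2 => (bcost b1 + bcost b2).+1
  end.

Definition upd (T : Type) (mem : nat -> nat -> T) (a i : nat) (v : T) :
  nat -> nat -> T :=
  fun a' i' => if (a' == a) && (i' == i) then v else mem a' i'.

Section Semantics.
Variable R : realType.

Record state := State {
  nmem : nat -> nat -> nat;
  rmem : nat -> nat -> R }.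

Fixpoint neval (s : state) (e : nexpr) : nat :=
  match e with
  | NConst k => k
  | NLoad a i => nmem s a (neval s i)
  | NAdd e1 e2 => neval s e1 + neval s e2
  | NSub e1 e2 => neval s e1 - neval s e2
  end.

(* Division is total: x / 0 = 0. *)
Fixpoint reval (s : state) (e : rexpr) : R :=
  match e with
  | RZero => 0%R
  | ROne => 1%R
  | RLoad a i => rmem s a (neval s i)
  | RAdd e1 e2 => (reval s e1 + reval s e2)%R
  | RSub e1 e2 => (reval s e1 - reval s e2)%R
  | RMul e1 e2 => (reval s e1 * reval s e2)%R
  | RDiv e1 e2 => (reval s e1 / reval s e2)%R
  end.

Fixpoint beval (s : state) (b : bexpr) : bool :=
  match b with
  | NEq e1 e2 => neval s e1 == neval s e2
  | NLt e1 e2 => neval s e1 < neval s e2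
  | RLe e1 e2 => (reval s e1 <= reval s e2)%R
  | RLt e1 e2 => (reval s e1 < reval s e2)%R
  | BNot b1 => ~~ beval s b1
  | BAnd b1 b2 => beval s b1 && beval s b2
  end.

Definition nstore (s : state) (a i v : nat) : state :=
  State (upd (nmem s) a i v) (rmem s).

Definition rstore (s : state) (a i : nat) (v : R) : state :=
  State (nmem s) (upd (rmem s) a i v).

(* exec P s t s': started in s, the program P halts in s' after time t. *)
Inductive exec : program -> state -> nat -> state -> Prop :=
  | ExecSkip s : exec Skip s 1 s
  | ExecNStore s a i e :
      exec (NStore a i e) s (ncost i + ncost e).+1
        (nstore s a (neval s i) (neval s e))
  | ExecRStore s a i e :
      exec (RStore a i e) s (ncost i + rcost e).+1
        (rstore s a (neval s i) (reval s e))
  | ExecSeq P1 P2 s1 t1 s2 t2 s3 :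
      exec P1 s1 t1 s2 -> exec P2 s2 t2 s3 ->
      exec (Seq P1 P2) s1 (t1 + t2) s3
  | ExecIfTrue b P1 P2 s t s' :
      beval s b -> exec P1 s t s' ->
      exec (If b P1 P2) s (bcost b + t).+1 s'
  | ExecIfFalse b P1 P2 s t s' :
      ~~ beval s b -> exec P2 s t s' ->
      exec (If b P1 P2) s (bcost b + t).+1 s'
  | ExecWhileTrue b P s1 t1 s2 t2 s3 :
      beval s1 b -> exec P s1 t1 s2 -> exec (While b P) s2 t2 s3 ->
      exec (While b P) s1 (bcost b + t1 + t2).+1 s3
  | ExecWhileFalse b P s :
      ~~ beval s b -> exec (While b P) s (bcost b).+1 s.

(* Hence "there is a halting run such that" means "the run halts and". *)
Lemma exec_det P s t1 s1 t2 s2 :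
  exec P s t1 s1 -> exec P s t2 s2 -> t1 = t2 /\ s1 = s2.
Proof.
have absurd (b : bool) (Q : Prop) : b -> ~~ b -> Q by move=> ->.
move=> H; elim: H t2 s2 => {P s t1 s1}.
- by move=> s t s' H; inversion H.
- by move=> s a i e t s' H; inversion H.
- by move=> s a i e t s' H; inversion H.
- move=> P1 P2 s1 t1 s2 t2 s3 _ IH1 _ IH2 t s' H; inversion H; subst.
  have [? ?] := IH1 _ _ ltac:(eassumption); subst.
  by have [? ?] := IH2 _ _ ltac:(eassumption); subst.
- move=> b P1 P2 s t s' Hb _ IH t2 s2 H; inversion H; subst.
    by have [? ?] := IH _ _ ltac:(eassumption); subst.
  by apply: (absurd (beval s b)).
- move=> b P1 P2 s t s' Hb _ IH t2 s2 H; inversion H; subst.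
    by apply: (absurd (beval s b)).
  by have [? ?] := IH _ _ ltac:(eassumption); subst.
- move=> b P s1 t1 s2 t2 s3 Hb _ IH1 _ IH2 t s' H; inversion H; subst.
    have [? ?] := IH1 _ _ ltac:(eassumption); subst.
    by have [? ?] := IH2 _ _ ltac:(eassumption); subst.
  by apply: (absurd (beval s' b)).
- move=> b P s Hb t s' H; inversion H; subst => //.
  by apply: (absurd (beval s b)).
Qed.

(* The dimensions are in natural-number arrays 0 and 1; the matrices of lower
   and of upper bounds are stored in row-major order in real arrays 0 and 1.
   All other memory cells have arbitrary initial contents. *)
Definition input_loaded m n (M : imatrix R m n) (s : state) : Prop :=
  [/\ nmem s 0 0 = m,
      nmem s 1 0 = n,
      forall (i : 'I_m) (j : 'I_n), rmem s 0 (i * n + j) = imx_lo M i j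
    & forall (i : 'I_m) (j : 'I_n), rmem s 1 (i * n + j) = imx_up M i j].

(* The answer is in natural-number array 2 (1 for YES, 0 for NO), the
   permutations, with indices counted from 0, in arrays 3 and 4. *)
Definition outputs_yes m n (s : state) (sigma : 'S_m) (rho : 'S_n) : Prop :=
  [/\ nmem s 2 0 = 1,
      forall i : 'I_m, nmem s 3 i = sigma i
    & forall j : 'I_n, nmem s 4 j = rho j].

Definition outputs_no (s : state) : Prop := nmem s 2 0 = 0.

End Semantics.

(* Main.v *)
Require Import Defs.
From HB Require Import structures.
From mathcomp Require Import all_boot all_order all_fingroup all_algebra.
From mathcomp Require Import boolp reals.
From mathcomp Require Import zify lra.

Set Implicit Arguments.
Unset Strict Implicit.
Unset Printing Implicit Defensive.

Import Order.TTheory GRing.Theory Num.Theory.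

(* When every entry is a nontrivial interval, the strong Monge inequality
   up_ij + up_kl <= lo_il + lo_kj (for i before k and j before l) implies
   lo_ij - lo_il < lo_kj - lo_kl.  Hence, once two columns j and l are ordered
   (which is no restriction, since both orders can be reversed together), the
   keys lo_ij - lo_il strictly increase along any valid row order, which is
   therefore the sorted one; the first two rows then determine the column order
   in the same way.  It remains to check the candidate orders, and by
   summation the inequalities for adjacent rows and columns suffice.  Sorting by
   counting predecessors is quadratic in the number of keys. *)

(** * Cost-bounded Hoare logic *)

Section Runs.
Variable R : realType.
Implicit Types (P : program) (s : state R) (Q : state R -> Prop).

(** A total-correctness triple with time bound [T]. By determinism of [exec], the run asserted to
    exist is the only one. *)
Definition runs P s T Q := exists t s', [/\ exec P s t s', t <= T & Q s'].

Lemma runs_weaken P s T T' Q Q' :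
  runs P s T Q -> T <= T' -> (forall s', Q s' -> Q' s') -> runs P s T' Q'.
Proof.
move=> [t [s' [H le Qs]]] leT imp; exists t, s'; split=> //; last exact: imp.
exact: leq_trans leT.
Qed.

Lemma runs_seq P1 P2 s T1 T2 Q1 Q :
  runs P1 s T1 Q1 -> (forall s1, Q1 s1 -> runs P2 s1 T2 Q) ->
  runs (Seq P1 P2) s (T1 + T2) Q.
Proof.
move=> [t1 [s1 [H1 le1 Q1s]]] /(_ _ Q1s) [t2 [s2 [H2 le2 Q2]]].
by exists (t1 + t2), s2; split=> //; [apply: ExecSeq H1 H2 | apply: leq_add].
Qed.

Fixpoint loop_free P : bool :=
  match P with
  | While _ _ => false
  | Seq P1 P2 | If _ P1 P2 => loop_free P1 && loop_free P2
  | _ => true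
  end.

(** Meaningful on loop-free programs only; [While] gets a dummy value. *)
Fixpoint run P s : state R :=
  match P with
  | NStore a i e => nstore s a (neval s i) (neval s e)
  | RStore a i e => rstore s a (neval s i) (reval s e)
  | Seq P1 P2 => run P2 (run P1 s)
  | If b P1 P2 => if beval s b then run P1 s else run P2 s
  | _ => s
  end.

(** For loop-free programs, an upper bound on the time: both branches of [If] are charged, which
    keeps it independent of the state. *)
Fixpoint pcost P : nat :=
  match P with
  | NStore _ i e => (ncost i + ncost e).+1
  | RStore _ i e => (ncost i + rcost e).+1
  | Seq P1 P2 => pcost P1 + pcost P2
  | If b P1 P2 => (bcost b + (pcost P1 + pcost P2)).+1
  | _ => 1
  end.

Lemma runs_loop_free P s Q :
  loop_free P -> Q (run P s) -> runs P s (pcost P) Q.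
Proof.
move=> lf Qs; suff [t [H le]] : exists t, exec P s t (run P s) /\ t <= pcost P.
  by exists t, (run P s).
elim: P s lf {Qs} => //=.
- by move=> s _; exists 1; split=> //; constructor.
- by move=> a i e s _; eexists; split; [constructor|].
- by move=> a i e s _; eexists; split; [constructor|].
- move=> P1 IH1 P2 IH2 s /andP[/IH1 {}IH1 /IH2 {}IH2].
  have [t1 [H1 le1]] := IH1 s; have [t2 [H2 le2]] := IH2 (run P1 s).
  by exists (t1 + t2); split; [apply: ExecSeq H1 H2 | apply: leq_add].
- move=> b P1 IH1 P2 IH2 s /andP[/IH1 {}IH1 /IH2 {}IH2].
  have [t1 [H1 le1]] := IH1 s; have [t2 [H2 le2]] := IH2 s.
  case: ifP => [bT|/negbT bF].
    by exists (bcost b + t1).+1; split; [apply: ExecIfTrue | lia].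
  by exists (bcost b + t2).+1; split; [apply: ExecIfFalse | lia].
Qed.

Lemma runs_seq_loop_freel P1 P2 s T Q :
  loop_free P1 -> runs P2 (run P1 s) T Q -> runs (Seq P1 P2) s (pcost P1 + T) Q.
Proof.
move=> lf H; apply: (runs_seq (Q1 := eq (run P1 s))); first exact: runs_loop_free.
by move=> _ <-.
Qed.

Fixpoint nwrites P : seq nat :=
  match P with
  | NStore a _ _ => [:: a]
  | Seq P1 P2 | If _ P1 P2 => nwrites P1 ++ nwrites P2
  | While _ P1 => nwrites P1
  | _ => [::]
  end.

Fixpoint rwrites P : seq nat :=
  match P with
  | RStore a _ _ => [:: a]
  | Seq P1 P2 | If _ P1 P2 => rwrites P1 ++ rwrites P2
  | While _ P1 => rwrites P1
  | _ => [::]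
  end.

(** A syntactic approximation at the granularity of whole arrays. It carries facts about unwritten
    arrays past loops, so that invariants only describe what a loop changes. *)
Definition frame P s s' :=
  (forall a, a \notin nwrites P -> nmem s' a = nmem s a) /\
  (forall a, a \notin rwrites P -> rmem s' a = rmem s a).

Lemma frame_trans P s1 s2 s3 : frame P s1 s2 -> frame P s2 s3 -> frame P s1 s3.
Proof.
by move=> [n1 r1] [n2 r2]; split=> a aP; [rewrite n2 ?n1 | rewrite r2 ?r1].
Qed.

Lemma frame_sub P P' s s' :
  {subset nwrites P <= nwrites P'} -> {subset rwrites P <= rwrites P'} ->
  frame P s s' -> frame P' s s'.
Proof.
by move=> nP rP [n r]; split=> a aP;
  [apply/n/(contra _ aP)/nP | apply/r/(contra _ aP)/rP].
Qed.

Lemma upd_other (T : Type) (mem : nat -> nat -> T) a i v a' :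
  a' != a -> upd mem a i v a' = mem a'.
Proof. by move=> /negbTE aa'; apply: funext => x; rewrite /upd aa'. Qed.

Lemma exec_frame P s t s' : exec P s t s' -> frame P s s'.
Proof.
elim=> {P s t s'} //=.
- by move=> s a i e; split=> // a'; rewrite inE; apply: upd_other.
- by move=> s a i e; split=> // a'; rewrite inE; apply: upd_other.
- move=> P1 P2 s1 t1 s2 t2 s3 _ IH1 _ IH2; apply: (@frame_trans _ _ s2).
    by apply: frame_sub IH1 => a; rewrite /= mem_cat => ->.
  by apply: frame_sub IH2 => a; rewrite /= mem_cat orbC => ->.
- by move=> b P1 P2 s t s' _ _; apply: frame_sub => a; rewrite /= mem_cat => ->.
- by move=> b P1 P2 s t s' _ _; apply: frame_sub => a; rewrite /= mem_cat orbC => ->.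
- by move=> b P s1 t1 s2 t2 s3 _ _ IH1 _; apply: frame_trans.
Qed.

Lemma runs_frame P s T Q :
  runs P s T Q -> runs P s T (fun s' => frame P s s' /\ Q s').
Proof.
by move=> [t [s' [H le Qs]]]; exists t, s'; split=> //; split=> //; apply: exec_frame H.
Qed.

Lemma runs_seq_loop_freer P1 P2 s T Q1 Q :
  loop_free P2 -> runs P1 s T Q1 ->
  (forall s', frame P1 s s' -> Q1 s' -> Q (run P2 s')) ->
  runs (Seq P1 P2) s (T + pcost P2) Q.
Proof.
move=> lf /runs_frame H imp; apply: runs_seq H _ => s' [fs' Q1s'].
exact/runs_loop_free/imp.
Qed.

(** Indexing the invariant by the iteration number and tying the test to [i < N] yields termination
    and the time bound together: [N] passes, then one failing test. *)
Lemma runs_while b P s C N (I : nat -> state R -> Prop) :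
  (forall i s1, i <= N -> frame P s s1 -> I i s1 -> beval s1 b = (i < N)) ->
  (forall i s1, i < N -> frame P s s1 -> I i s1 -> runs P s1 C (I i.+1)) ->
  I 0 s -> runs (While b P) s (N * (bcost b + C).+1 + (bcost b).+1) (I N).
Proof.
move=> bE step.
(* Induction on the number [d] of passes left. *)
suff H d i s1 : i + d = N -> frame P s s1 -> I i s1 ->
    runs (While b P) s1 (d * (bcost b + C).+1 + (bcost b).+1) (I N).
  by apply: (H N 0).
elim: d i s1 => [|d IH] i s1.
  rewrite addn0 => -> fs1 Is; exists (bcost b).+1, s1; split=> //.
  by apply: ExecWhileFalse; rewrite (bE N) ?ltnn.
rewrite addnS -addSn => iN fs1 Is.
have iltN : i < N by rewrite -iN addSn ltnS leq_addr.
have [t [s2 [H le Is2]]] := step _ _ iltN fs1 Is.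
have fs2 := frame_trans fs1 (exec_frame H).
have [t' [s3 [H' le' Q]]] := IH _ _ iN fs2 Is2.
exists (bcost b + t + t').+1, s3; split=> //; last by rewrite mulSn; lia.
by apply: ExecWhileTrue H H'; rewrite (bE i) // ltnW.
Qed.

Definition cell a := NLoad a (NConst 0).
Definition setn a e := NStore a (NConst 0) e.
Definition incr a := setn a (NAdd (cell a) (NConst 1)).
Definition for_ v e P :=
  Seq (setn v (NConst 0)) (While (NLt (cell v) e) (Seq P (incr v))).

(** The body establishes the invariant for the state whose counter already holds [i.+1], so the
    increment is treated here once and for all. Besides [C] and [ncost e], a pass costs 3 for the
    test, 6 for the increment and 1 for the loop; the 7 is 3 for the initialisation and 4 for the
    failing test. *)
Lemma runs_for (v : nat) e P s C N (I : nat -> state R -> Prop) :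
  v \notin nwrites P ->
  (forall s1, frame (for_ v e P) s s1 -> neval s1 e = N) ->
  (forall i s1, i < N -> frame (for_ v e P) s s1 -> nmem s1 v 0 = i -> I i s1 ->
     runs P s1 C (fun s2 => I i.+1 (nstore s2 v 0 i.+1))) ->
  I 0 (nstore s v 0 0) ->
  runs (for_ v e P) s (N * (C + ncost e + 10) + (ncost e + 7)) (I N).
Proof.
move=> vP eE step I0; set s0 := nstore s v 0 0.
have fs0 s1 : frame (Seq P (incr v)) s0 s1 -> frame (for_ v e P) s s1.
  move=> f; apply: (@frame_trans _ _ s0).
    split=> // a; rewrite /= inE negb_or => /andP[av _]; exact: upd_other.
  by apply: frame_sub f => // a aP; rewrite /= inE aP orbT.
pose I' i s1 := nmem s1 v 0 = i /\ I i s1.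
have H : runs (While (NLt (cell v) e) (Seq P (incr v))) s0
    (N * (bcost (NLt (cell v) e) + (C + 6)).+1 + (bcost (NLt (cell v) e)).+1) (I' N).
  apply: runs_while => [i s1 iN /fs0/eE eN [vi _]|i s1 iN /fs0 fs1 [vi Ii]|].
  - by rewrite /= vi eN.
  - apply: runs_seq (runs_frame (step _ _ iN fs1 vi Ii)) _ => s2 [[fs2 _] Is2].
    apply: runs_loop_free => //=.
    have -> : nmem s2 v 0 + 1 = i.+1 by rewrite fs2 // vi addn1.
    by split=> //; rewrite /= /upd !eqxx.
  - by split=> //; rewrite /= /upd !eqxx.
apply: (runs_weaken (@runs_seq_loop_freel (setn v (NConst 0)) _ s _ _ isT H)).
  by rewrite /=; lia.
by move=> s' [].
Qed.

End Runs.

(** * Sorting by counting predecessors *)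

Section Rank.
Variable R : realType.
Implicit Type key : nat -> R.

(* Ties are broken by index, so that sorting always gives a permutation. *)
Definition precedes key k i : bool :=
  ((key k < key i)%R || ((key k <= key i)%R && (k < i))).

Definition rank key L i := \sum_(k < L) precedes key k i.

Lemma precedes_irr key i : precedes key i i = false.
Proof. by rewrite /precedes !ltxx ltnn andbF. Qed.

Lemma precedes_trans key : transitive (precedes key).
Proof.
move=> y x z /orP[xy|/andP[xy xy']] /orP[yz|/andP[yz yz']]; apply/orP.
- by left; apply: lt_trans yz.
- by left; apply: lt_le_trans yz.
- by left; apply: le_lt_trans yz.
- by right; rewrite (le_trans xy yz) (ltn_trans xy' yz').
Qed.

Lemma precedes_total key i k : i != k -> precedes key i k || precedes key k i.
Proof. by rewrite /precedes neq_ltn; case: (ltgtP (key i) (key k)). Qed.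

(** By transitivity every predecessor of [i] precedes [k], and [i] itself is counted for [k] but not
    for [i]. *)
Lemma rank_lt key L i k : i < L -> precedes key i k -> rank key L i < rank key L k.
Proof.
move=> iL ik; rewrite /rank (bigD1 (Ordinal iL)) //=.
rewrite [X in _ < X](bigD1 (Ordinal iL)) //= precedes_irr ik ltnS.
apply: leq_sum => j _; case ji: (precedes key j i) => //.
by rewrite (precedes_trans ji ik).
Qed.

Lemma rank_inj key L i k : i < L -> k < L -> rank key L i = rank key L k -> i = k.
Proof.
move=> iL kL eq; apply/eqP/negP => /negP /precedes_total-/(_ key).
by by case/orP => [/(rank_lt iL)|/(rank_lt kL)]; rewrite eq ltnn.
Qed.

(** An index is not its own predecessor, so at most [L - 1] indices are counted. *)
Lemma rank_ltn key L i : i < L -> rank key L i < L.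
Proof.
move=> iL; rewrite /rank (bigD1 (Ordinal iL)) //= precedes_irr add0n.
rewrite (@leq_trans (\sum_(k < L | k != Ordinal iL) 1).+1) //.
  by rewrite ltnS; apply: leq_sum => j _; apply: leq_b1.
by rewrite -[leqRHS]card_ord -sum1_card [leqRHS](bigD1 (Ordinal iL)).
Qed.

Lemma sum_ltn L p : p <= L -> \sum_(q < L) (q < p) = p.
Proof.
move=> pL; rewrite (eq_bigr (fun q : 'I_L => if q < p then 1 else 0)).
  by rewrite -big_mkcond (big_ord_narrow pL) sum1_card card_ord.
by move=> q _; case: ltnP.
Qed.

Section Perm.
Variables (key : nat -> R) (L : nat).

Definition rank_ord (i : 'I_L) : 'I_L := Ordinal (rank_ltn key (ltn_ord i)).

Lemma rank_ord_inj : injective rank_ord.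
Proof. by move=> i k [/rank_inj E]; apply/val_inj/E. Qed.

(** [rank_ord] sends an index to its position; the inverse lists the indices in sorted order. *)
Definition sort_perm : 'S_L := (perm rank_ord_inj)^-1%g.

(** Since keys strictly increase along [tau], the predecessors of [tau p] are exactly the [tau q]
    with [q < p]. There are [p] of them, so [tau] inverts the rank. *)
Lemma sort_perm_unique (tau : 'S_L) :
  (forall p q : 'I_L, p < q -> (key (tau p) < key (tau q))%R) -> sort_perm = tau.
Proof.
move=> incr; apply/permP => p; apply: (canLR (permK _)); rewrite permE.
apply: val_inj => /=; rewrite /rank (reindex_inj (@perm_inj _ tau)) /=.
rewrite -{1}(sum_ltn (ltnW (ltn_ord p))); apply: eq_bigr => q _; congr nat_of_bool.
case: (ltngtP q p) => [qp|pq|/val_inj->]; last by rewrite precedes_irr.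
  by rewrite /precedes incr.
by apply/esym; rewrite /precedes lt_gtF ?incr //= leNgt incr.
Qed.

(** The program scatters each index to the cell given by its rank; this identifies the resulting
    array with [sort_perm]. *)
Lemma sort_permE (out : nat -> nat) :
  (forall i, i < L -> out (rank key L i) = i) ->
  forall j : 'I_L, out j = sort_perm j.
Proof.
move=> outE j; rewrite -{1}(permKV (perm rank_ord_inj) j) -/sort_perm.
by rewrite permE outE.
Qed.
End Perm.
End Rank.

(** * The program *)

Section Programs.
Variable R : realType.
Implicit Types (s : state R).

(* Array 8 tabulates the products i * n, as natural-number expressions have no
   multiplication.  Arrays 5 and 6 hold loop counters, array 7 an accumulator;
   the real arrays 2 and 3 hold the row and column keys. *)
Definition offsets : program :=
  Seq (setn 7 (NConst 0))
    (for_ 5 (cell 0) (Seq (NStore 8 (cell 5) (cell 7))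
                          (setn 7 (NAdd (cell 7) (cell 1))))).

Lemma runs_offsets s :
  runs offsets s (nmem s 0 0 * 30 + 30)
    (fun s' => forall i, i < nmem s 0 0 -> nmem s' 8 i = i * nmem s 1 0).
Proof.
set m := nmem s 0 0; set n := nmem s 1 0.
pose I i s1 := nmem s1 7 0 = i * n /\ forall i', i' < i -> nmem s1 8 i' = i' * n.
apply: runs_weaken (runs_seq_loop_freel _ (@runs_for _ _ _ _ _ 12 m I _ _ _ _)) _ _ => //.
- by move=> s2 [f _]; rewrite /= f.
- move=> i s2 im [f _] vi [off7 off8]; apply: runs_loop_free => //; split=> /=.
    by rewrite /upd /= off7 f // mulSn addnC.
  by move=> i'; rewrite ltnS /upd /= vi leq_eqVlt;
    case: eqP => [->|_ /off8 //]; rewrite off7.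
- by rewrite /=; lia.
- by move=> s' [].
Qed.

(** The key expression [e] finds its index in the counter, array 5. *)
Definition fill_keys d k e : program := for_ 5 (cell d) (RStore k (cell 5) e).

Lemma runs_fill_keys (d k : nat) e (f : nat -> R) s :
  d != 5 ->
  (forall s1, frame (fill_keys d k e) s s1 -> reval s1 e = f (nmem s1 5 0)) ->
  runs (fill_keys d k e) s (nmem s d 0 * (rcost e + 20) + 20)
    (fun s' => forall i, i < nmem s d 0 -> rmem s' k i = f i).
Proof.
move=> d5 eE; pose I i s1 := forall i', i' < i -> rmem s1 k i' = f i'.
apply: runs_weaken (@runs_for _ _ _ _ _ _ (nmem s d 0) I _ _ _ _) _ _ => //.
- by move=> s1 [fn _] /=; rewrite fn //= !inE negb_or d5.
- move=> i s1 im fs1 vi Ii; apply: runs_loop_free => //= i' /=.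
  rewrite ltnS /upd /= vi eE // vi leq_eqVlt.
  by rewrite eqxx /=; case: eqP => [->|_ /Ii].
- by rewrite /=; lia.
Qed.

(** Conditions offer no disjunction, so that of [precedes] is written by De Morgan. *)
Definition precedes_test k : bexpr :=
  let kv := RLoad k (cell 6) in let iv := RLoad k (cell 5) in
  BNot (BAnd (BNot (RLt kv iv)) (BNot (BAnd (RLe kv iv) (NLt (cell 6) (cell 5))))).

Definition sort_keys d k out : program :=
  for_ 5 (cell d)
    (Seq (Seq (setn 7 (NConst 0))
              (for_ 6 (cell d) (If (precedes_test k) (incr 7) Skip)))
         (NStore out (cell 7) (cell 5))).

Lemma runs_sort_keys (d k out : nat) s :
  d \notin [:: 5; 6; 7; out] -> out \notin [:: 5; 6; 7] ->
  let L := nmem s d 0 in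
  runs (sort_keys d k out) s (L * (L * 50 + 70) + 20)
    (fun s' => forall i, i < L -> nmem s' out (rank (rmem s k) L i) = i).
Proof.
rewrite !inE !negb_or => /and4P[d5 d6 d7 dout] /and3P[out5 out6 out7] L.
set key := rmem s k.
pose I i s1 := forall i', i' < i -> i' < L -> nmem s1 out (rank key L i') = i'.
have dE s1 : frame (sort_keys d k out) s s1 -> nmem s1 d 0 = L.
  by move=> [f _]; rewrite f //= !inE !negb_or d5 d6 d7 dout.
apply: runs_weaken (@runs_for _ _ _ _ _ (L * 50 + 50) L I _ _ _ _) _ _ => //.
- by rewrite /= !inE !(eq_sym _ out) (negbTE out5).
- move=> i s1 iL fs1 vi Ii.
  pose J j s2 := nmem s2 7 0 = \sum_(q < j) precedes key q i.
  apply: runs_weaken (runs_seq_loop_freer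
    (Q := fun s2 => I i.+1 (nstore s2 5 0 i.+1)) _ (runs_seq_loop_freel _
    (@runs_for _ _ _ _ _ _ L J _ _ _ _)) _) _ _ => //.
  + by move=> s3 [f _] /=; rewrite f /= ?upd_other ?dE // !inE !negb_or d6 d7.
  + move=> j s3 jL [fn fr] v6 Jj; apply: runs_loop_free => //=.
    have v5 : nmem s3 5 0 = i by rewrite fn.
    have kE : rmem s3 k = key by rewrite fr //= fs1.2.
    rewrite /J big_ord_recr /= /upd v5 v6 kE negb_and !negbK /precedes /=.
    by case: ifP => _ /=; rewrite Jj /= ?addn0.
  + by rewrite /J big_ord0.
  + move=> s2 [f _] rE i'; rewrite ltnS /upd /=.
    rewrite rE f //= vi -/(rank key L i) (upd_other _ _ _ out5) /upd eqxx.
    case: (altP (i' =P i)) => [-> _ _|ne le i'L]; first by rewrite eqxx.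
    (* Ranks are distinct, so the new store cannot overwrite an earlier one. *)
    case: eqP => [/rank_inj E|_]; first by rewrite E ?eqxx in ne.
    rewrite f ?Ii //; first by rewrite ltn_neqAle ne.
    by rewrite /= !inE !negb_or out6 out7.
  + by rewrite /=; lia.
- by rewrite /=; nia.
- by move=> s' Is' i iL; apply: Is'.
Qed.

Definition check_test : bexpr :=
  let ent a di dj := RLoad a (NAdd (NLoad 8 (NLoad 3 (NAdd (cell 5) (NConst di))))
                                   (NLoad 4 (NAdd (cell 6) (NConst dj)))) in
  RLe (RAdd (ent 1 0 0) (ent 1 1 1)) (RAdd (ent 0 0 1) (ent 0 1 0)).

Definition check : program :=
  Seq (setn 2 (NConst 1))
    (for_ 5 (NSub (cell 0) (NConst 1))
       (for_ 6 (NSub (cell 1) (NConst 1))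
          (If check_test Skip (setn 2 (NConst 0))))).

(** [check_test] as a function of the counters, read in the state before the loops, which leave the
    arrays involved unchanged. *)
Definition check_cond s i j : bool :=
  let ent a i j := rmem s a (nmem s 8 (nmem s 3 i) + nmem s 4 j) in
  (ent 1 i j + ent 1 i.+1 j.+1 <= ent 0 i j.+1 + ent 0 i.+1 j)%R.

Lemma runs_check s :
  let m := nmem s 0 0 in let n := nmem s 1 0 in
  runs check s (m * (n * 100 + 100) + 100)
   (fun s' => nmem s' 2 0 =
      all (fun i => all (check_cond s i) (iota 0 n.-1)) (iota 0 m.-1)).
Proof.
move=> m n.
(* [A i] says that all tests for the rows before [i] succeed; the inner invariant adds the first [j]
   tests of row [i]. *)
pose A i := all (fun i => all (check_cond s i) (iota 0 n.-1)) (iota 0 i).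
pose I i s1 := nmem s1 2 0 = A i.
apply: runs_weaken (runs_seq_loop_freel _ (@runs_for _ _ _ _ _ _ m.-1 I _ _ _ _)) _ _ => //.
- by move=> s2 [f _]; rewrite /= f // subn1.
- move=> i s2 im [fn fr] v5 Ii.
  pose J j s3 := nmem s3 2 0 = A i && all (check_cond s i) (iota 0 j) :> nat.
  apply: runs_weaken (@runs_for _ _ _ _ _ _ n.-1 J _ _ _ _) _ _ => //.
  + by move=> s3 [f _]; rewrite /= f // fn // subn1.
  + move=> j s3 jn [fn' fr'] v6 Jj; apply: runs_loop_free => //.
    have v5' : nmem s3 5 0 = i by rewrite fn'.
    have condE : beval s3 check_test = check_cond s i j.
      rewrite /check_cond /= v5' v6 !addn0 !addn1.
      by rewrite !fr' // !fr // !(fn' 3) // !(fn' 4) // !(fn' 8) // !fn //.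
    have -> : run (If check_test Skip (setn 2 (NConst 0))) s3 =
        if check_cond s i j then s3 else nstore s3 2 0 0 by rewrite -condE.
    rewrite /J -(addn1 j) iotaD all_cat add0n /= andbT.
    by case: ifP => _ /=; rewrite /upd /= ?Jj ?andbT ?andbF.
  + by rewrite /J /= andbT.
  + move=> s3; rewrite /J /I /= /upd /= => ->.
    by rewrite {2}/A -(addn1 i) iotaD all_cat add0n /= andbT.
- by rewrite /=; nia.
Qed.
End Programs.

(** * The complete program and its running time *)

Section MongeProgram.
Variable R : realType.
Implicit Types (s : state R).

(* If n = 1, resp. m = 1, the row keys, resp. column keys, involve junk cells;
   any order is then valid. *)
Definition row_key : rexpr :=
  RSub (RLoad 0 (NLoad 8 (cell 5))) (RLoad 0 (NAdd (NLoad 8 (cell 5)) (NConst 1))).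

(** The rows compared are those in sorted positions 0 and 1, so the row order has to be computed
    first. *)
Definition col_key : rexpr :=
  let ent i := RLoad 0 (NAdd (NLoad 8 (NLoad 3 (NConst i))) (cell 5)) in
  RSub (ent 0) (ent 1).

Definition monge_program : program :=
  Seq offsets (Seq (fill_keys 0 2 row_key) (Seq (sort_keys 0 2 3)
    (Seq (fill_keys 1 3 col_key) (Seq (sort_keys 1 3 4) check)))).

(** Everything is expressed in the final state alone, so that the correctness argument can forget
    the execution. *)
Definition monge_program_post m n s' : Prop :=
  [/\ forall i, i < m -> nmem s' 8 i = i * n,
      forall i, i < m ->
        rmem s' 2 i = (rmem s' 0 (nmem s' 8 i) - rmem s' 0 (nmem s' 8 i + 1))%R,
      forall i, i < m -> nmem s' 3 (rank (rmem s' 2) m i) = i,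
      forall j, j < n ->
        rmem s' 3 j = (rmem s' 0 (nmem s' 8 (nmem s' 3 0) + j) -
                       rmem s' 0 (nmem s' 8 (nmem s' 3 1) + j))%R
    & (forall j, j < n -> nmem s' 4 (rank (rmem s' 3) n j) = j) /\
      nmem s' 2 0 =
        all (fun i => all (check_cond s' i) (iota 0 n.-1)) (iota 0 m.-1)].

Lemma runs_monge_program s :
  let m := nmem s 0 0 in let n := nmem s 1 0 in
  0 < m -> 0 < n ->
  runs monge_program s (1000 * (m ^ 2 + n ^ 2 + m * n)) (monge_program_post m n).
Proof.
move=> m n m_gt0 n_gt0.
(* The bounds of the six stages in order. As [m] and [n] are positive, the linear and constant terms
   are absorbed by the quadratic ones. *)
apply: (@runs_weaken _ _ _ ((m * 30 + 30) + ((m * (rcost row_key + 20) + 20) +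
  ((m * (m * 50 + 70) + 20) + ((n * (rcost col_key + 20) + 20) +
  ((n * (n * 50 + 70) + 20) + (m * (n * 100 + 100) + 100))))))
  _ (monge_program_post m n)) => //; last by rewrite /=; nia.
apply: runs_seq (runs_frame (runs_offsets s)) _ => s1 [[fn1 fr1] off].
have m1 : nmem s1 0 0 = m by rewrite fn1.
have n1 : nmem s1 1 0 = n by rewrite fn1.
have := @runs_fill_keys _ 0 2 row_key
  (fun i => rmem s1 0 (nmem s1 8 i) - rmem s1 0 (nmem s1 8 i + 1))%R s1 isT.
rewrite m1 => /(_ _)/runs_frame H2; apply: runs_seq (H2 _) _ => {H2}.
  by move=> s2 [fn2 fr2]; rewrite /= fn2 // fr2.
move=> s2 [[fn2 fr2] key2].
have m2 : nmem s2 0 0 = m by rewrite fn2.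
have n2 : nmem s2 1 0 = n by rewrite fn2.
have := runs_frame (@runs_sort_keys _ 0 2 3 s2 isT isT); rewrite m2 => H3.
apply: runs_seq H3 _ => s3 [[fn3 fr3] sort3].
have n3 : nmem s3 1 0 = n by rewrite fn3.
have := @runs_fill_keys _ 1 3 col_key
  (fun j => rmem s3 0 (nmem s3 8 (nmem s3 3 0) + j) -
            rmem s3 0 (nmem s3 8 (nmem s3 3 1) + j))%R s3 isT.
rewrite n3 => /(_ _)/runs_frame H4; apply: runs_seq (H4 _) _ => {H4}.
  by move=> s4 [fn4 fr4]; rewrite /= !(fn4 8) // !(fn4 3) // fr4.
move=> s4 [[fn4 fr4] key4].
have n4 : nmem s4 1 0 = n by rewrite fn4.
have := runs_frame (@runs_sort_keys _ 1 3 4 s4 isT isT); rewrite n4 => H5.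
apply: runs_seq H5 _ => s5 [[fn5 fr5] sort5].
have m5 : nmem s5 0 0 = m by rewrite fn5 // fn4 // fn3.
have n5 : nmem s5 1 0 = n by rewrite fn5.
have := runs_frame (runs_check s5); rewrite m5 n5 => H6.
apply: runs_weaken H6 _ _ => // s6 [[fn6 fr6] chk].
(* No later stage writes the arrays that hold the results of an earlier one, so all results can be
   read off in the final state. *)
have n8 : nmem s6 8 = nmem s1 8 by rewrite fn6 // fn5 // fn4 // fn3 // fn2.
have n3E : nmem s6 3 = nmem s3 3 by rewrite fn6 // fn5 // fn4.
have n4E : nmem s6 4 = nmem s5 4 by rewrite fn6.
have r2 : rmem s6 2 = rmem s2 2 by rewrite fr6 // fr5 // fr4 // fr3.
have r3 : rmem s6 3 = rmem s4 3 by rewrite fr6 // fr5.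
have r0 : rmem s6 0 = rmem s1 0 by rewrite fr6 // fr5 // fr4 // fr3 // fr2.
have n83 : nmem s3 8 = nmem s1 8 by rewrite fn3 // fn2.
have r03 : rmem s3 0 = rmem s1 0 by rewrite fr3 // fr2.
split.
- by move=> i im; rewrite n8 off.
- by move=> i im; rewrite r2 r0 n8 key2.
- by move=> i im; rewrite n3E r2 sort3.
- by move=> j jn; rewrite r3 r0 n8 n3E key4 // n83 r03.
- split; first by move=> j jn; rewrite n4E r3 sort5.
  rewrite chk; congr nat_of_bool; apply: eq_all => i; apply: eq_all => j.
  by rewrite /check_cond !(fn6 3) // !(fn6 4) // !(fn6 8) // !fr6.
Qed.
End MongeProgram.

(** * Strong Monge orders *)

Section StrongMonge.
Local Open Scope ring_scope.
Variables (R : realType) (m n : nat).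
Implicit Types (M : imatrix R m n) (A : 'M[R]_(m, n)).

(** Adjacent inequalities telescope, first along the columns and then along the rows. *)
Lemma monge_adjacent A :
  (forall (i k : 'I_m) (j l : 'I_n), k = i.+1 :> nat -> l = j.+1 :> nat ->
     A i j + A k l <= A i l + A k j) -> monge A.
Proof.
move=> adj.
(* Adjacent rows, columns at distance [d]. *)
have adjr (d : nat) (i k : 'I_m) (j l : 'I_n) : k = i.+1 :> nat ->
    l = (j + d)%N :> nat -> A i j + A k l <= A i l + A k j.
  elim: d l => [|d IH] l ki jl; first by have -> : l = j by apply: val_inj; rewrite /= jl addn0.
  have pn : (j + d < n)%N by have := ltn_ord l; lia.
  have := IH (Ordinal pn) ki erefl; have := adj i k (Ordinal pn) l ki.
  by rewrite jl addnS => /(_ erefl) h1 h2; lra.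
(* Rows at distance [d], arbitrary columns. *)
suff H (d : nat) (i k : 'I_m) (j l : 'I_n) : k = (i + d)%N :> nat -> (j <= l)%N ->
    A i j + A k l <= A i l + A k j.
  by move=> i k j l ik jl; apply: (H (k - i)%N); lia.
elim: d k => [|d IH] k ik jl.
  have -> : k = i by apply: val_inj; rewrite /= ik addn0.
  by rewrite addrC.
have pm : (i + d < m)%N by have := ltn_ord k; lia.
have := IH (Ordinal pm) erefl jl; have := adjr (l - j)%N (Ordinal pm) k j l.
by rewrite ik addnS subnKC // => /(_ erefl erefl) h1 h2; lra.
Qed.

Lemma strong_monge_adjacent M :
  (forall (i k : 'I_m) (j l : 'I_n), k = i.+1 :> nat -> l = j.+1 :> nat ->
     imx_up M i j + imx_up M k l <= imx_lo M i l + imx_lo M k j) ->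
  strong_monge M.
Proof.
move=> adj A inA; apply: monge_adjacent => i k j l ki lj.
have := adj i k j l ki lj.
by have /andP[_ ?] := inA i j; have /andP[_ ?] := inA k l;
  have /andP[? _] := inA i l; have /andP[? _] := inA k j; lra.
Qed.

(** The extreme case is the member of [M] with upper bounds at (i,j) and (k,l) and lower bounds
    everywhere else. *)
Lemma strong_mongeP M :
  strong_monge M <->
  forall (i k : 'I_m) (j l : 'I_n), (i < k)%N -> (j < l)%N ->
    imx_up M i j + imx_up M k l <= imx_lo M i l + imx_lo M k j.
Proof.
split=> [strong i k j l ik jl | ineq]; last first.
  by apply: strong_monge_adjacent => i k j l ki lj; apply: ineq; rewrite ?ki ?lj.
pose A : 'M[R]_(m, n) := \matrix_(a, b)
  if (a == i) && (b == j) || (a == k) && (b == l) then imx_up M a b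
  else imx_lo M a b.
have inA : in_imatrix M A.
  by move=> a b; rewrite mxE; case: ifP => _; rewrite lexx imx_le.
have ki : (k == i) = false by apply/eqP => E; rewrite E ltnn in ik.
have lj : (l == j) = false by apply/eqP => E; rewrite E ltnn in jl.
have := strong A inA i k j l ik jl.
by rewrite !mxE !eqxx ki lj (eq_sym i) ki (eq_sym j) lj /=.
Qed.
End StrongMonge.

(** * Reversal of orders and monotonicity of the keys *)

Section Permuted.
Local Open Scope ring_scope.
Variables (R : realType) (m n : nat) (M : imatrix R m n).

Definition rev_perm L : 'S_L := perm (@rev_ord_inj L).

(** Exchanging [i] with [k] and [j] with [l] at once only permutes the summands on each side of the
    Monge inequality. *)
Lemma strong_monge_rev (sigma : 'S_m) (rho : 'S_n) :
  strong_monge (permute_imx M sigma rho) ->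
  strong_monge (permute_imx M (rev_perm m * sigma) (rev_perm n * rho)).
Proof.
move=> /strong_mongeP H; apply/strong_mongeP => i k j l ik jl.
have rik : (rev_ord k < rev_ord i)%N by rewrite /=; have := ltn_ord k; lia.
have rjl : (rev_ord l < rev_ord j)%N by rewrite /=; have := ltn_ord l; lia.
have := H _ _ _ _ rik rjl; rewrite !mxE !permM !permE.
by rewrite addrC [X in _ <= X -> _]addrC.
Qed.

Hypothesis nontrivM : nontrivial_entries M.
Variables (sigma : 'S_m) (rho : 'S_n).
Hypothesis strongM : strong_monge (permute_imx M sigma rho).
Let lo := imx_lo M.

(** The inverse permutation gives the position of a column. In rows [sigma p] and [sigma q],
    nontriviality makes the sum of lower bounds on the diagonal strictly smaller than the sum of
    upper bounds, which is at most the antidiagonal sum of lower bounds. Strictness is what makes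
    the sorted order unique. *)
Lemma row_keys_increase (c d : 'I_n) (p q : 'I_m) :
  (rho^-1%g c < rho^-1%g d)%N -> (p < q)%N ->
  lo (sigma p) c - lo (sigma p) d < lo (sigma q) c - lo (sigma q) d.
Proof.
move=> cd pq; have /strong_mongeP/(_ _ _ _ _ pq cd) := strongM.
rewrite !mxE !permKV.
by have := nontrivM (sigma p) c; have := nontrivM (sigma q) d; rewrite /lo; lra.
Qed.

Lemma col_keys_increase (a b : 'I_m) (p q : 'I_n) :
  (sigma^-1%g a < sigma^-1%g b)%N -> (p < q)%N ->
  lo a (rho p) - lo b (rho p) < lo a (rho q) - lo b (rho q).
Proof.
move=> ab pq; have /strong_mongeP/(_ _ _ _ _ ab pq) := strongM.
rewrite !mxE !permKV.
by have := nontrivM a (rho p); have := nontrivM b (rho q); rewrite /lo; lra.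
Qed.
End Permuted.

(* By reversing both orders, a given pair of columns may be put in a given order. *)
Lemma monge_permutable_ordered (R : realType) m n (M : imatrix R m n) (c d : 'I_n) :
  c != d -> monge_permutable M ->
  exists (sigma : 'S_m) (rho : 'S_n),
    strong_monge (permute_imx M sigma rho) /\ rho^-1%g c < rho^-1%g d.
Proof.
move=> cd [sigma [rho strong]]; have [lt|le] := ltnP (rho^-1%g c) (rho^-1%g d).
  by exists sigma, rho.
exists (rev_perm m * sigma)%g, (rev_perm n * rho)%g.
split; first exact: strong_monge_rev.
have revV (x : 'I_n) : (rev_perm n * rho)^-1%g x = rev_ord (rho^-1%g x).
  by apply: (canLR (permK _)); rewrite permM permE rev_ordK permKV.
have ne : rho^-1%g c != rho^-1%g d :> nat.
  by apply: contra cd => /eqP/val_inj/perm_inj->.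
by rewrite !revV /=; have := ltn_ord (rho^-1%g c); lia.
Qed.

(** * Correctness of the computed answer *)

Section Correctness.
Variables (R : realType) (m n : nat) (M : imatrix R m n) (s' : state R).
Hypotheses (nontrivM : nontrivial_entries M)
  (loE : forall (i : 'I_m) (j : 'I_n), rmem s' 0 (i * n + j) = imx_lo M i j)
  (upE : forall (i : 'I_m) (j : 'I_n), rmem s' 1 (i * n + j) = imx_up M i j)
  (post : monge_program_post m n s').

Let sigma : 'S_m := sort_perm (rmem s' 2) m.
Let rho : 'S_n := sort_perm (rmem s' 3) n.

Let sigmaE (i : 'I_m) : nmem s' 3 i = sigma i.
Proof. by case: post => _ _ sort3 _ _; exact: sort_permE. Qed.

Let rhoE (j : 'I_n) : nmem s' 4 j = rho j.
Proof. by case: post => _ _ _ _ [sort4 _]; exact: sort_permE. Qed.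

Let offE (i : 'I_m) : nmem s' 8 i = i * n.
Proof. by case: post => off *; apply: off. Qed.

Lemma check_condE (i k : 'I_m) (j l : 'I_n) : k = i.+1 :> nat -> l = j.+1 :> nat ->
  let N := permute_imx M sigma rho in
  check_cond s' i j =
    (imx_up N i j + imx_up N k l <= imx_lo N i l + imx_lo N k j)%R.
Proof.
by move=> ki lj; rewrite /check_cond -ki -lj !sigmaE !rhoE !offE !upE !loE !mxE.
Qed.

Lemma check_all :
  reflect (strong_monge (permute_imx M sigma rho))
    (all (fun i => all (check_cond s' i) (iota 0 n.-1)) (iota 0 m.-1)).
Proof.
apply: (iffP allP) => [chk | /strong_mongeP strong i].
  apply: strong_monge_adjacent => i k j l ki lj; rewrite -check_condE //.
  have /allP : all (check_cond s' i) (iota 0 n.-1).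
    by apply: chk; rewrite mem_iota; have := ltn_ord k; lia.
  by apply; rewrite mem_iota; have := ltn_ord l; lia.
rewrite mem_iota => im; apply/allP => j; rewrite mem_iota => jn.
have [i0 i1] : i < m /\ i.+1 < m by lia.
have [j0 j1] : j < n /\ j.+1 < n by lia.
rewrite (@check_condE (Ordinal i0) (Ordinal i1) (Ordinal j0) (Ordinal j1)) //.
exact: strong.
Qed.

Lemma sorted_strong_monge :
  monge_permutable M -> strong_monge (permute_imx M sigma rho).
Proof.
(* With a single row or column the Monge condition is vacuous, whatever order the junk keys
   produce. *)
have [n_le1 _|n_gt1] := leqP n 1.
  by move=> A _ i k j l _; have := ltn_ord l; lia.
have [m_le1 _|m_gt1] := leqP m 1.
  by move=> A _ i k j l; have := ltn_ord k; lia.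
(* [c] and [d] are the first two columns of the input, whereas [a] and [b] are the first two
   positions in the sorted row order. *)
pose c := Ordinal (ltnW n_gt1); pose d := Ordinal n_gt1.
pose a := Ordinal (ltnW m_gt1); pose b := Ordinal m_gt1.
case/(@monge_permutable_ordered _ _ _ _ c d isT) => sigma' [rho' [strong cd]].
case: post => _ key2 _ key3 _.
have keyr (i : 'I_m) : rmem s' 2 i = (imx_lo M i c - imx_lo M i d)%R.
  by rewrite key2 // offE -(loE i d) -[i * n]addn0 -(loE i c).
have sigma_eq : sigma = sigma'.
  apply: sort_perm_unique => p q pq; rewrite !keyr.
  exact: (row_keys_increase nontrivM strong).
have keyc (j : 'I_n) :
    rmem s' 3 j = (imx_lo M (sigma a) j - imx_lo M (sigma b) j)%R.
  by rewrite key3 // (sigmaE a) (sigmaE b) !offE !loE.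
have rho_eq : rho = rho'.
  apply: sort_perm_unique => p q pq; rewrite !keyc sigma_eq.
  (* The two rows compared occupy positions 0 and 1 of [sigma'], hence are in the required order. *)
  by apply: (col_keys_increase nontrivM strong) => //; rewrite !permK.
by rewrite sigma_eq rho_eq.
Qed.

Lemma program_yes :
  monge_permutable M -> outputs_yes s' sigma rho /\ strong_monge (permute_imx M sigma rho).
Proof.
move=> /sorted_strong_monge strong; split=> //; split=> //.
by case: post => _ _ _ _ [_ ->]; case: check_all.
Qed.

(** A successful check would make the computed orders a witness of permutability. *)
Lemma program_no : ~ monge_permutable M -> outputs_no s'.
Proof.
move=> notM; rewrite /outputs_no; case: post => _ _ _ _ [_ ->].
by case: check_all => // strong; case: notM; exists sigma, rho.
Qed.
End Correctness.

Theorem theorem6p1 (R : realType) :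
  exists (P : program) (c : nat),
  forall (m n : nat) (M : imatrix R m n),
    0 < m -> 0 < n -> nontrivial_entries M ->
  forall s : state R, input_loaded M s ->
  exists (t : nat) (s' : state R),
    [/\ exec P s t s',
        t <= c * (m ^ 2 + n ^ 2 + m * n),
        monge_permutable M ->
          exists (sigma : 'S_m) (rho : 'S_n),
            outputs_yes s' sigma rho /\ strong_monge (permute_imx M sigma rho)
      & ~ monge_permutable M -> outputs_no s'].
Proof.
exists monge_program, 1000 => m n M m_gt0 n_gt0 nontrivM s [sm sn slo sup].
have [] := runs_frame (@runs_monge_program R s _ _); rewrite ?sm ?sn //.
move=> t [s' [ex le [[_ fr] post]]].
(* The program never writes real arrays 0 and 1, so the final state still holds the input matrix. *)
have loE (i : 'I_m) (j : 'I_n) : rmem s' 0 (i * n + j) = imx_lo M i j by rewrite fr.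
have upE (i : 'I_m) (j : 'I_n) : rmem s' 1 (i * n + j) = imx_up M i j by rewrite fr.
exists t, s'; split=> // [yes | no].
  by do 2 eexists; apply: (program_yes nontrivM loE upE post yes).
exact: (program_no loE upE post no).
Qed.
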